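(* Let $A,B,\beta,\gamma$ be real constants, $n$ a natural number, and let $a_0$ be the Jacobi polynomial, i.e. a nonzero polynomial solution of degree $n$ of $$(1-x^2)f''+\bigl(A-B-(A+B+2)x\bigr)f'+n(n+A+B+1)f=0 .$$ Consider planar quadratic systems $$\dot x=p_2(x),\qquad \dot y=y^2+(q_{11}x+q_{10})y+q_{22}x^2+q_{21}x+q_{20},\qquad p_2(x)=p_{22}x^2+p_{21}x+p_{20},$$ for which the equation $p_2w''+rw'+\kappa w=0$, with $r(x)=(2p_{22}+q_{11}-2\beta)x+p_{21}+q_{10}-2\gamma$ and $\kappa$ constant, is the Jacobi equation $(1-x^2)w''+\bigl(A-B-(A+B+2)x\bigr)w'+n(n+A+B+1)w=0$ (i.e. $p_2=1-x^2$, $r=A-B-(A+B+2)x$, $\kappa=n(n+A+B+1)$). (1) The most general such system which admits the invariant algebraic curve $a_0\bigl(y-((\beta-q_{11})x+\gamma-q_{10})\bigr)+p_2a_0'=0$ with cofactor $y+\beta x+\gamma$ (that is, the only one for which this curve is invariant with this cofactor) is $$\begin{aligned} \dot x={}&1-x^2,\\ \dot y={}&y^2+(2\beta-A-B)xy+(2\gamma+A-B)y\\ &+\bigl(\beta^2+\beta-n(n+1)-(1+n+\beta)(A+B)\bigr)x^2\\ &+\bigl((\beta-\gamma)A-(\gamma+\beta)B+2\gamma\beta\bigr)x\\ &+(n+1-\gamma)B+(n+1+\gamma)A+n(n+1)+\gamma^2-\beta . \end{aligned}\qquad (J)$$ (2) Consider the system, in variables $(X,Y)$ with time $T$ and parameters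 $a,b,c,\beta,\tilde\gamma$, $$\begin{aligned} \frac{dX}{dT}={}&X(1-X),\\ \frac{dY}{dT}={}&Y^2+(2\beta-a-b+1)XY+(c-1+2\tilde\gamma)Y+\tilde\gamma(\tilde\gamma+c-1)\\ &+\bigl(\beta^2+(2-a-b)\beta+(a-1)(b-1)\bigr)X^2+\bigl(c\beta-ab+(1-\tilde\gamma)(-2\beta-1+a+b)\bigr)X . \end{aligned}$$ With $a=-n$, $b=1+n+A+B$, $c=1+A$, under the change $X=\frac{x+1}{2}$, $Y=\frac y2$, $T=2t$ and the parameter renaming $\gamma=\beta+2\tilde\gamma$, this system coincides with system $(J)$ (where the dot denotes $d/dt$).
   Context: For a polynomial vector field associated with $\dot x=P(x,y)$, $\dot y=Q(x,y)$, of degree $m=\max\{\deg P,\deg Q\}$, and a polynomial $g(x,y)$, the curve $g=0$ is an invariant algebraic curve with cofactor $K$ if $P\,\partial g/\partial x+Q\,\partial g/\partial y=Kg$, where $K$ is a polynomial of degree at most $m-1$. Primes denote derivatives with respect to $x$. *)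

(* Defs.v *)
From HB Require Import structures.
From mathcomp Require Import all_boot all_order all_algebra.
From mathcomp Require Import mpoly.
From mathcomp Require Import reals.
(* [derive] and [normed_module] are only Required: importing them together with
   [mpoly] makes their notations clash. *)
From mathcomp Require normed_module derive.
Export normed_module.numFieldNormedType.Exports.

Set Implicit Arguments.
Unset Strict Implicit.
Unset Printing Implicit Defensive.

Import Order.TTheory GRing.Theory Num.Theory.
Local Open Scope ring_scope.

Section PlanarSystems.
Variable R : realType.
Implicit Types (P Q g K : {mpoly R[2]}) (p w : {poly R}).

Definition vx : {mpoly R[2]} := 'X_(0 : 'I_2).
Definition vy : {mpoly R[2]} := 'X_(1 : 'I_2).

(* p(x) as a polynomial in (x, y). *)
Definition in_x p : {mpoly R[2]} := horner_alg vx p.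

(* The polynomial system x' = F.1(x, y), y' = F.2(x, y). *)
Definition planar_system : Type := ({mpoly R[2]} * {mpoly R[2]})%type.

(* [msize] is the total degree plus one (and 0 for the zero polynomial). *)
Definition system_degree (F : planar_system) : nat :=
  (maxn (msize F.1) (msize F.2)).-1.

(* For m = [system_degree F], [msize K <= m] means deg K <= m - 1. *)
Definition invariant_curve (F : planar_system) g K : Prop :=
  F.1 * g^`M(0) + F.2 * g^`M(1) = K * g /\ (msize K <= system_degree F)%N.

(* The differential equations of F hold for the curve (x, y) at time t. *)
Definition satisfies_at (F : planar_system) (x y : R -> R) (t : R) : Prop :=
  let v := tnth [tuple x t; y t] in
  derive.is_derive t 1 x F.1.@[v] /\ derive.is_derive t 1 y F.2.@[v].

(* [(p, r, k)] encodes the operator w |-> p w'' + r w' + k w. *)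
Definition ode2 : Type := ({poly R} * {poly R} * R)%type.

Definition ode2_solution (L : ode2) w : Prop :=
  L.1.1 * w^`()^`() + L.1.2 * w^`() + L.2 *: w = 0.

Definition jacobi_ode (A B : R) (n : nat) : ode2 :=
  (1 - 'X^2, (A - B)%:P - (A + B + 2) *: 'X, n%:R * (n%:R + A + B + 1)).

Definition jacobi_polynomial (A B : R) (n : nat) w : Prop :=
  size w = n.+1 /\ ode2_solution (jacobi_ode A B n) w.

Definition quadratic_system p2 (q11 q10 q22 q21 q20 : R) : planar_system :=
  (in_x p2,
   vy ^+ 2 + (q11 *: vx + q10%:MP) * vy
     + q22 *: vx ^+ 2 + q21 *: vx + q20%:MP).

Definition system_J (A B beta gamma : R) (n : nat) : planar_system :=
  let N : R := n%:R in
  (1 - vx ^+ 2,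
   vy ^+ 2 + (2 * beta - A - B) *: (vx * vy) + (2 * gamma + A - B) *: vy
     + (beta ^+ 2 + beta - N * (N + 1) - (1 + N + beta) * (A + B)) *: vx ^+ 2
     + ((beta - gamma) * A - (gamma + beta) * B + 2 * gamma * beta) *: vx
     + ((N + 1 - gamma) * B + (N + 1 + gamma) * A + N * (N + 1)
        + gamma ^+ 2 - beta)%:MP).

Definition hypergeometric_system (a b c beta gammat : R) : planar_system :=
  (vx * (1 - vx),
   vy ^+ 2 + (2 * beta - a - b + 1) *: (vx * vy)
     + (c - 1 + 2 * gammat) *: vy + (gammat * (gammat + c - 1))%:MP
     + (beta ^+ 2 + (2 - a - b) * beta + (a - 1) * (b - 1)) *: vx ^+ 2
     + (c * beta - a * b + (1 - gammat) * (- (2 * beta) - 1 + a + b)) *: vx).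

End PlanarSystems.

(* Main.v *)
Require Import Defs.
From mathcomp Require Import all_boot all_order all_algebra.
From mathcomp Require Import mpoly ring.
From mathcomp Require Import reals.
From mathcomp Require boolp realfun.

Set Implicit Arguments.
Unset Strict Implicit.
Unset Printing Implicit Defensive.

Import Order.TTheory GRing.Theory Num.Theory.
Local Open Scope ring_scope.

(** Every system in sight has the form x' = p(x), y' = y^2 + q1(x) y + q2(x),
    a Riccati equation in y, and the theorem's first part is an instance of a
    fact about such systems. Let k(x) be given and put s = k - q1. For the
    curve g = w (y - s) + p w' the expression p g_x + y' g_y - (y + k) g is a
    priori quadratic in y; the coefficients of y^2 and of y vanish identically,
    and the remaining one is
      p (p w'' + (p' + q1 - 2k) w') + w (q2 + k s - p s').
    If w solves p w'' + (p' + q1 - 2k) w' + kappa w = 0, this is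
      w (q2 + k s - p s' - kappa p)
    ([invariance_defect]), and w is a nonzero element of an integral domain.
    Invariance of the curve therefore holds for exactly one q2, namely
    kappa p + p s' - k s ([riccati_curve_invariantP]).

    For k = beta x + gamma the middle coefficient p' + q1 - 2k is the r of the
    statement, so being the Jacobi equation determines p and q1
    ([jacobi_odeP]), and the formula for q2 then expands to the y-free part of
    (J) ([free_term_JE]). Since p, q1 and q2 can be read off from the system
    ([riccati_system_inj]), equality with (J) is the same as these three
    conditions. The bound on the degree of the cofactor y + k holds because
    p = 1 - x^2 makes the system at least quadratic.

    In the second part the rescaling multiplies dX/dT and dY/dT by 4
    ([is_derive_rescale]), and 4 times the right-hand sides of the
    hypergeometric system are those of (J) in the old variables
    ([hypergeometric_rescale]). *)

(** * Polynomials in x inside polynomials in x and y *)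

Section InX.
Variable R : realType.
Implicit Types p q : {poly R}.

Lemma in_x0 : in_x 0 = 0 :> {mpoly R[2]}.
Proof. exact: rmorph0. Qed.

Lemma in_x1 : in_x 1 = 1 :> {mpoly R[2]}.
Proof. exact: rmorph1. Qed.

Lemma in_xC (c : R) : in_x c%:P = c%:MP.
Proof. by rewrite /in_x horner_algC alg_mpolyC. Qed.

Lemma in_xX : in_x 'X = vx R.
Proof. exact: horner_algX. Qed.

Lemma in_xD p q : in_x (p + q) = in_x p + in_x q.
Proof. exact: rmorphD. Qed.

Lemma in_xN p : in_x (- p) = - in_x p.
Proof. exact: rmorphN. Qed.

Lemma in_xM p q : in_x (p * q) = in_x p * in_x q.
Proof. exact: rmorphM. Qed.

Lemma in_xXn p i : in_x (p ^+ i) = in_x p ^+ i.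
Proof. exact: rmorphXn. Qed.

Lemma in_xZ c p : in_x (c *: p) = c *: in_x p.
Proof. by rewrite -mul_polyC in_xM in_xC mul_mpolyC. Qed.

(* in_xXn comes before in_xM, which would also match 'X^2 by conversion. *)
Definition in_xE :=
  (in_x0, in_x1, in_xD, in_xN, in_xXn, in_xM, in_xZ, in_xC, in_xX).

Lemma mderiv_var n (i j : 'I_n) : ('X_j : {mpoly R[n]})^`M(i) = (i == j)%:R.
Proof.
rewrite mderivX mnmE eq_sym; case: eqP => [->|_]; last by rewrite scale0r.
by rewrite scale1r -[X in (X - _)%MM]add0m addmK mpolyX0.
Qed.

Lemma deriv_in_x p : (in_x p)^`M(0) = in_x p^`().
Proof.
elim/poly_ind: p => [|p c IH].
  by rewrite deriv0 !in_x0 mderiv0.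
rewrite derivD derivM derivX derivC !in_xE mderivD mderivC mderivM IH.
rewrite {2}/vx mderiv_var mulr1.
by rewrite !addr0.
Qed.

Lemma deriv_y_in_x p : (in_x p)^`M(1) = 0.
Proof.
elim/poly_ind: p => [|p c IH].
  by rewrite in_x0 mderiv0.
rewrite !in_xE mderivD mderivC mderivM IH /vx mderiv_var.
by rewrite mul0r mulr0 !addr0.
Qed.

(** Substituting a constant for y gives a left inverse of [in_x], which brings
    identities between bivariate polynomials back to {poly R}. *)
Definition at_y (c : R) (g : {mpoly R[2]}) : {poly R} :=
  mmap polyC (tnth [tuple 'X; c%:P]) g.

Lemma at_yD c g h : at_y c (g + h) = at_y c g + at_y c h.
Proof. exact: rmorphD. Qed.

Lemma at_yM c g h : at_y c (g * h) = at_y c g * at_y c h.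
Proof. exact: rmorphM. Qed.

Lemma at_y_vy c : at_y c (vy R) = c%:P.
Proof. by rewrite /at_y mmapX mmap1U. Qed.

Lemma at_y_in_x c p : at_y c (in_x p) = p.
Proof.
elim/poly_ind: p => [|p d IH].
  by rewrite in_x0 /at_y mmap0.
by rewrite !in_xE at_yD at_yM IH /at_y mmapC mmapX mmap1U.
Qed.

End InX.

(** * Invariant curves of Riccati systems *)

Section Riccati.
Variable R : realType.
Implicit Types p q k w : {poly R}.

Definition riccati_system p q1 q2 : planar_system R :=
  (in_x p, vy R ^+ 2 + in_x q1 * vy R + in_x q2).

(** Setting y = 0 in the second component isolates q2; setting y = 1 then
    isolates q1. *)
Lemma riccati_system_inj p q1 q2 p' q1' q2' :
  riccati_system p q1 q2 = riccati_system p' q1' q2' ->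
  [/\ p = p', q1 = q1' & q2 = q2'].
Proof.
move=> E.
have Ep : in_x p = in_x p' := congr1 fst E.
have Eq : vy R ^+ 2 + in_x q1 * vy R + in_x q2 =
  vy R ^+ 2 + in_x q1' * vy R + in_x q2' := congr1 snd E.
have H c : q1 * c%:P + q2 = q1' * c%:P + q2'.
  move: (congr1 (at_y c) Eq); rewrite !(expr2, at_yD, at_yM, at_y_vy, at_y_in_x).
  by rewrite -!addrA => /addrI.
have E2 : q2 = q2' by move: (H 0); rewrite !mulr0 !add0r.
split=> //; first by rewrite -[p](at_y_in_x 0) Ep at_y_in_x.
by move: (H 1); rewrite E2 !mulr1 => /addIr.
Qed.

Definition riccati_curve p q1 k w : {mpoly R[2]} :=
  in_x w * (vy R - in_x (k - q1)) + in_x p * in_x w^`().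

(** The curve is built so that y cancels from the left-hand side: the
    coefficient of y is w (q1 + s - k) with s = k - q1. In what remains, p is a
    factor of the part containing w', which the differential equation turns
    into a multiple of w. *)
Lemma invariance_defect p q1 q2 k w (kappa : R) :
  ode2_solution (p, p^`() + q1 - k - k, kappa) w ->
  let F := riccati_system p q1 q2 in
  let g := riccati_curve p q1 k w in
  F.1 * g^`M(0) + F.2 * g^`M(1) - (vy R + in_x k) * g =
  in_x (w * (q2 - (kappa *: p + p * (k - q1)^`() - k * (k - q1)))).
Proof.
rewrite /ode2_solution /= => Hw.
rewrite /riccati_curve !(mderivD, mderivN, mderivM) !deriv_y_in_x.
rewrite !deriv_in_x !mderiv_var /= derivB.
move: (congr1 (fun f => in_x (p * f)) Hw).
rewrite mulr0 -!mul_polyC !in_xE => E.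
(* The two sides differ by p times the differential equation. *)
rewrite -[RHS]addr0 -[X in _ = _ + X]E; ring.
Qed.

(** The defect is w times the difference of the two sides of the equation for
    q2, and {poly R} has no zero divisors. *)
Lemma riccati_curve_invariantP p q1 q2 k w (kappa : R) : w != 0 ->
  ode2_solution (p, p^`() + q1 - k - k, kappa) w ->
  let F := riccati_system p q1 q2 in
  let g := riccati_curve p q1 k w in
  F.1 * g^`M(0) + F.2 * g^`M(1) = (vy R + in_x k) * g <->
  q2 = kappa *: p + p * (k - q1)^`() - k * (k - q1).
Proof.
move=> w0 Hw F g; have := invariance_defect q2 Hw; rewrite /= -/g => E.
rewrite /F /=.
split=> [H|H]; last first.
  by apply/eqP; rewrite -subr_eq0 E H subrr mulr0 in_x0.
move: E; rewrite H subrr => /(congr1 (at_y 0)); rewrite at_y_in_x.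
rewrite -in_x0 at_y_in_x => /esym/eqP.
by rewrite mulf_eq0 (negPf w0) subr_eq0 => /eqP.
Qed.

End Riccati.

(** * The Jacobi equation and system (J) *)

Section Jacobi.
Variable R : realType.

(** The first coefficient of the equation gives p, and then the second is an
    affine equation for q1. *)
Lemma jacobi_odeP (A B beta gamma : R) n (p q1 : {poly R}) :
  let k := beta *: 'X + gamma%:P in
  (exists kappa : R, (p, p^`() + q1 - k - k, kappa) = jacobi_ode A B n) <->
  p = 1 - 'X^2 /\ q1 = (2 * beta - A - B) *: 'X + (2 * gamma + A - B)%:P.
Proof.
move=> k; rewrite /jacobi_ode.
have dp : (1 - 'X^2 : {poly R})^`() = - (2 * 'X).
  by rewrite derivB derivXn derivC sub0r -mulr_natl.
split=> [[kappa [-> E _]] | [-> ->]]; last first.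
  exists (n%:R * (n%:R + A + B + 1)); congr (_, _, _).
  by rewrite dp /k -!mul_polyC; ring.
have -> : q1 = ((1 - 'X^2)^`() + q1 - k - k) - (1 - 'X^2)^`() + k + k by ring.
by rewrite E dp /k -!mul_polyC; split=> //; ring.
Qed.

Definition free_term_J (A B beta gamma : R) (n : nat) : {poly R} :=
  let N : R := n%:R in
  (beta ^+ 2 + beta - N * (N + 1) - (1 + N + beta) * (A + B)) *: 'X^2
  + ((beta - gamma) * A - (gamma + beta) * B + 2 * gamma * beta) *: 'X
  + ((N + 1 - gamma) * B + (N + 1 + gamma) * A + N * (N + 1)
        + gamma ^+ 2 - beta)%:P.

Lemma quadratic_systemE (p : {poly R}) q11 q10 q22 q21 q20 :
  quadratic_system p q11 q10 q22 q21 q20 =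
  riccati_system p (q11 *: 'X + q10%:P) (q22 *: 'X^2 + q21 *: 'X + q20%:P).
Proof. by rewrite /riccati_system !in_xE /quadratic_system !addrA. Qed.

Lemma system_JE (A B beta gamma : R) n :
  system_J A B beta gamma n =
  riccati_system (1 - 'X^2)
    ((2 * beta - A - B) *: 'X + (2 * gamma + A - B)%:P)
    (free_term_J A B beta gamma n).
Proof.
rewrite /riccati_system /free_term_J !in_xE /system_J; congr (_, _).
by rewrite -!mul_mpolyC; ring.
Qed.

(** The right-hand side of [riccati_curve_invariantP] at the Jacobi data
    is the part of (J) that is free of y. *)
Lemma free_term_JE (A B beta gamma : R) n :
  let q1 := (2 * beta - A - B) *: 'X + (2 * gamma + A - B)%:P in
  let k := beta *: 'X + gamma%:P in
  (n%:R * (n%:R + A + B + 1)) *: (1 - 'X^2) + (1 - 'X^2) * (k - q1)^`()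
    - k * (k - q1) = free_term_J A B beta gamma n.
Proof.
rewrite /= /free_term_J !(derivB, derivD, derivZ, derivX, derivC).
rewrite -!mul_polyC; ring.
Qed.

(** The cofactor has degree at most 1, and the component 1 - x^2 alone forces
    the system to have degree at least 2. *)
Lemma msize_cofactor (beta gamma : R) (F : planar_system R) :
  F.1 = in_x (1 - 'X^2) ->
  (msize (vy R + beta *: vx R + gamma%:MP) <= system_degree F)%N.
Proof.
move=> F1; have hK : (msize (vy R + beta *: vx R + gamma%:MP) <= 2)%N.
  apply: leq_trans (msizeD_le _ _) _; rewrite geq_max msizeC.
  rewrite (leq_trans (leq_b1 _)) // andbT.
  apply: leq_trans (msizeD_le _ _) _; rewrite geq_max.
  by rewrite (leq_trans (msizeZ_le _ _)) /vx /vy msizeX mdeg1.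
apply: leq_trans hK _; rewrite /system_degree -ltnS.
suff h : (2 < msize F.1)%N by rewrite prednK leq_max ?h // (ltn_trans _ h).
(* Otherwise x^2 = 1 - F.1 would have degree at most 1. *)
rewrite ltnNge; apply/negP => h.
have : (msize (1 - F.1) <= 2)%N.
  by apply: leq_trans (msizeD_le _ _) _; rewrite geq_max msize1 msizeN h.
by rewrite F1 !in_xE subKr /vx mpolyXn msizeX mdegMn mdeg1.
Qed.

End Jacobi.

(** * Rescaling the variables and the time *)

Lemma is_derive_affine (R : realType) (f : R -> R) (m k e t d : R) :
  derive.is_derive (m * t) 1 f d ->
  derive.is_derive t 1 (fun v => k * f (m * v) + e) (k * m * d).
Proof.
move=> hf.
have hm := derive.is_deriveZ m (derive.is_derive_id t (1 : R)).
have hc := realfun.is_derive1_comp hf hm.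
have := derive.is_deriveD (derive.is_deriveZ k hc) (derive.is_derive_cst e t (1 : R)).
rewrite addr0 /GRing.scale /= mulr1 [d * m]mulrC mulrA. exact.
Qed.

(** Each of x and X is an affine function of the other with a rescaled
    argument: the factor 4 is 2 (from X = (x + e) / 2) times 2 (from T = 2t). *)
Lemma is_derive_rescale (R : realType) (x X : R -> R) (e t D : R) :
  (forall s, X (2 * s) = (x s + e) / 2) ->
  derive.is_derive (2 * t) 1 X D <-> derive.is_derive t 1 x (4 * D).
Proof.
move=> XE; split=> h.
  have -> : x = fun v => 2 * X (2 * v) + - e.
    by apply: boolp.funext => v; rewrite XE; field.
  by rewrite (_ : 4 * D = 2 * 2 * D); [apply: is_derive_affine | ring].
have -> : X = fun v => 2^-1 * x (2^-1 * v) + e / 2.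
  apply: boolp.funext => v.
  by rewrite -[v in LHS](@mulVKf _ 2) ?pnatr_eq0 // XE; field.
rewrite (_ : D = 2^-1 * 2^-1 * (4 * D)); last by field.
by apply: is_derive_affine; rewrite mulKf ?pnatr_eq0.
Qed.

Lemma meval_vx (R : realType) (a b : R) : (vx R).@[tnth [tuple a; b]] = a.
Proof. exact: mevalXU. Qed.

Lemma meval_vy (R : realType) (a b : R) : (vy R).@[tnth [tuple a; b]] = b.
Proof. exact: mevalXU. Qed.

Definition meval_planarE :=
  (mevalD, mevalN, mevalM, mevalZ, mevalC, meval1, expr2, meval_vx, meval_vy).

Lemma hypergeometric_rescale (R : realType) (A B beta gammat x y : R) (n : nat) :
  let H := hypergeometric_system (- n%:R) (1 + n%:R + A + B) (1 + A) beta gammat in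
  let J := system_J A B beta (beta + 2 * gammat) n in
  let V := tnth [tuple (x + 1) / 2; y / 2] in
  let v := tnth [tuple x; y] in
  4 * H.1.@[V] = J.1.@[v] /\ 4 * H.2.@[V] = J.2.@[v].
Proof.
by rewrite /= !meval_planarE; split; field.
Qed.

Theorem corollary6 (R : realType) (A B beta gamma : R) (n : nat) :
  (forall a0 : {poly R}, jacobi_polynomial A B n a0 ->
   forall p22 p21 p20 q11 q10 q22 q21 q20 : R,
   let p2 : {poly R} := p22 *: 'X^2 + p21 *: 'X + p20%:P in
   let r : {poly R} :=
     (2 * p22 + q11 - 2 * beta) *: 'X + (p21 + q10 - 2 * gamma)%:P in
   let F := quadratic_system p2 q11 q10 q22 q21 q20 in
   let curve :=
     in_x a0 * (vy R - ((beta - q11) *: vx R + (gamma - q10)%:MP))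
       + in_x p2 * in_x a0^`() in
   let cofactor := vy R + beta *: vx R + gamma%:MP in
   ((exists kappa : R, (p2, r, kappa) = jacobi_ode A B n) /\
    invariant_curve F curve cofactor)
   <-> F = system_J A B beta gamma n)
  /\
  (forall gammat : R, gamma = beta + 2 * gammat ->
   let a := - n%:R in
   let b := 1 + n%:R + A + B in
   let c := 1 + A in
   forall x y X Y : R -> R,
   (forall t, X (2 * t) = (x t + 1) / 2) ->
   (forall t, Y (2 * t) = y t / 2) ->
   forall t : R,
   satisfies_at (hypergeometric_system a b c beta gammat) X Y (2 * t)
   <-> satisfies_at (system_J A B beta gamma n) x y t).
Proof.
split=> [a0 [sz_a0 ode_a0] p22 p21 p20 q11 q10 q22 q21 q20 p2 r F curve cofactor
        |gammat -> a b c x y X Y XE YE t].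
  pose q1 := q11 *: 'X + q10%:P : {poly R}.
  pose q2 := q22 *: 'X^2 + q21 *: 'X + q20%:P : {poly R}.
  pose k := beta *: 'X + gamma%:P : {poly R}.
  have a0_neq0 : a0 != 0 by rewrite -size_poly_eq0 sz_a0.
  have FE : F = riccati_system p2 q1 q2 := quadratic_systemE _ _ _ _ _ _.
  have curveE : curve = riccati_curve p2 q1 k a0.
    rewrite /curve /riccati_curve /k /q1 !in_xE -!mul_mpolyC; ring.
  have cofactorE : cofactor = vy R + in_x k by rewrite /k !in_xE addrA.
  have rE : r = p2^`() + q1 - k - k.
    rewrite /r /p2 /q1 /k !(derivD, derivZ, derivXn, derivX, derivC) /=.
    rewrite -!mul_polyC; ring.
  have invariantP kappa : (p2, r, kappa) = jacobi_ode A B n ->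
      F.1 * curve^`M(0) + F.2 * curve^`M(1) = cofactor * curve <->
      q2 = kappa *: p2 + p2 * (k - q1)^`() - k * (k - q1).
    move=> E; rewrite FE curveE cofactorE; apply: riccati_curve_invariantP => //.
    by rewrite -rE E.
  split=> [[odeE [inv _]] | FJ].
    have [kappa kappaE] := odeE; have [_ _ kappaJ] := kappaE.
    have q2E := (invariantP _ kappaE).1 inv.
    move: odeE; rewrite rE => /jacobi_odeP[p2E q1E].
    by rewrite FE system_JE q2E p2E q1E kappaJ free_term_JE.
  have [p2E q1E q2E] : [/\ p2 = 1 - 'X^2,
      q1 = (2 * beta - A - B) *: 'X + (2 * gamma + A - B)%:P
    & q2 = free_term_J A B beta gamma n].
    by apply: riccati_system_inj; rewrite -FE FJ system_JE.
  have [kappa kappaE] : exists kappa, (p2, r, kappa) = jacobi_ode A B n.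
    by rewrite rE; apply/jacobi_odeP.
  split; first by exists kappa.
  split; last by apply: msize_cofactor; rewrite FE p2E.
  have [_ _ kappaJ] := kappaE.
  by apply/(invariantP _ kappaE); rewrite kappaJ p2E q1E q2E free_term_JE.
have YE0 s : Y (2 * s) = (y s + 0) / 2 by rewrite addr0 YE.
have [E1 E2] := hypergeometric_rescale A B beta gammat (x t) (y t) n.
rewrite /satisfies_at XE YE.
by rewrite (is_derive_rescale _ _ XE) (is_derive_rescale _ _ YE0) E1 E2.
Qed.
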